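(* For every real number $\varepsilon>0$ there is a real number $\delta>0$ such that for every circuit $\mathcal P$ on the unit circle $\mathscr C$, $$\mu(\mathcal P)<\delta \quad\text{implies that}\quad 0<\pi-\alpha(g(\mathcal P))<\varepsilon \quad\text{and}\quad 0<\alpha(G(\mathcal P))-\pi<\varepsilon .$$
   Context: $\mathscr C$ is the unit circle centered at $O$. A circuit on $\mathscr C$ is a finite sequence $\mathcal P=(P_1,\dots,P_{n+1})$ of points on $\mathscr C$ in counterclockwise order (going once around $\mathscr C$, with $P_1,\dots,P_n$ distinct) such that $P_{n+1}=P_1$; it is assumed throughout that the counterclockwise arc from each point of a circuit to the next is less than half of $\mathscr C$. The inscribed polygon $g(\mathcal P)$ is the polygon with vertices $P_1,\dots,P_n$ and edges $\overline{P_iP_{i+1}}$. The circumscribed polygon $G(\mathcal P)$ is the polygon whose vertices are the intersections of the lines tangent to $\mathscr C$ at adjacent points of the circuit. $\alpha(g(\mathcal P))$ and $\alpha(G(\mathcal P))$ denote the areas of these polygons. The mesh $\mu(\mathcal P)$ is the maximal edge length of $g(\mathcal P)$. The number $\pi$ is defined by $2\pi=\lim_{m\to\infty}p_3(m)$, where $p_3(m)$ is the perimeter of a regular polygon with $3\cdot 2^m$ edges inscribed in $\mathscr C$. *)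

(* Defs.v *)
From mathcomp Require Import all_boot all_order all_algebra.
From mathcomp Require Import all_classical all_reals all_analysis.
Set Implicit Arguments.
Unset Strict Implicit.
Unset Printing Implicit Defensive.
Import Order.TTheory GRing.Theory Num.Theory.
Import numFieldNormedType.Exports.
Local Open Scope classical_set_scope.
Local Open Scope ring_scope.

(* The norm of the library on R * R is the max norm, hence the separate Euclidean
   distance edist. *)

Section Plane.
Context {R : realType}.
Implicit Types A B C X : R * R.

Definition dot A B : R := A.1 * B.1 + A.2 * B.2.

Definition edist A B : R := Num.sqrt (dot (A - B) (A - B)).

Definition segment A B : set (R * R) :=
  [set (1 - s) *: A + s *: B | s in `[0, 1]%classic].

Definition angle A B C : R :=
  acos (dot (A - B) (C - B) / (edist A B * edist C B)).

(* For A on the unit circle: the line through A perpendicular to OA. *)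
Definition tangent_line A : set (R * R) := [set X | dot A (X - A) = 0].

End Plane.

(* A closed polygon is given by its cyclic list of vertices V : 'I_n -> R * R;
   its edges join V i to V (ordS i), where ordS is the cyclic successor. *)
Section Polygon.
Context {R : realType} (n : nat) (V : 'I_n -> R * R).

Definition polygon_boundary : set (R * R) :=
  \bigcup_(i in [set: 'I_n]) segment (V i) (V (ordS i)).

(* The part of the plane enclosed by the closed polygonal line: a point off the
   edges is enclosed when its component in the complement is bounded. *)
Definition polygon_region : set (R * R) :=
  polygon_boundary `|`
  [set X | ~ polygon_boundary X /\
           bounded_set (connected_component (~` polygon_boundary) X)].

Definition area : R :=
  fine (((@lebesgue_measure R) \x (@lebesgue_measure R))%E polygon_region).

Definition edge_length (i : 'I_n) : R := edist (V i) (V (ordS i)).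

Definition perimeter : R := \sum_(i < n) edge_length i.

Definition regular_polygon : Prop :=
  (forall i j : 'I_n, edge_length i = edge_length j) /\
  (forall i j : 'I_n,
     angle (V i) (V (ordS i)) (V (ordS (ordS i))) =
     angle (V j) (V (ordS j)) (V (ordS (ordS j)))).

End Polygon.

Section Circuit.
Context {R : realType} (n : nat) (P : 'I_n -> R * R).

(* P lists P_1, ..., P_n (with indices starting from 0); the closing point
   P_{n+1} = P_1 is left to ordS. The t i are polar angles of successive points.
   They increase (counterclockwise order) by 2 pi in total (once around), which
   makes the points distinct; each increment, the length of the arc from a point
   to the next, is less than the half circle pi. Here pi is the library's
   constant, twice the zero of cos in [0, 2]. *)
Definition is_circuit : Prop :=
  exists t : nat -> R,
    [/\ t n = t 0%N + 2 * pi,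
        forall i, (i < n)%N -> 0 < t i.+1 - t i < pi
      & forall i : 'I_n, P i = (cos (t i), sin (t i))].

Definition inscribed : 'I_n -> R * R := P.

Definition circumscribed (i : 'I_n) : R * R :=
  get (tangent_line (P i) `&` tangent_line (P (ordS i))).

Definition mesh : R := \big[Num.max/0]_(i < n) edge_length inscribed i.

End Circuit.

Section CirclePi.
Context {R : realType}.

(* All regular polygons with 3 * 2 ^ m edges inscribed in the unit circle have
   the same perimeter, so get selects the only element. *)
Definition p3 (m : nat) : R :=
  get [set p | exists P : 'I_(3 * 2 ^ m) -> R * R,
         [/\ is_circuit P, regular_polygon (inscribed P)
           & p = perimeter (inscribed P)]].

Definition circle_pi : R := limn p3 / 2.

End CirclePi.

(* Main.v *)
(** Let K be the intersection of the half-planes cut out by the edges of a convex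
    polygon around the origin. The polygonal line consists of the points of K at
    which some constraint is tight, so on its complement K is both open and closed,
    and a component meeting K stays in K and is bounded; a point outside K starts a
    radial ray that avoids K, so its component is unbounded. Hence the enclosed
    region is K. For a circuit whose half-arcs h all satisfy m <= cos h, the inscribed
    K lies between the discs of radius m and 1, and the circumscribed K between those
    of radius 1 and 1/m; the strict inequalities hold because the difference of the
    two sets contains an open set. Small edges make m close to 1. Finally, a regular
    inscribed polygon with n edges has perimeter 2 n sin (pi / n), which tends to
    2 pi, so [circle_pi] is the library's [pi]. *)

Require Import Defs.
From mathcomp Require Import all_boot all_order all_algebra.
From mathcomp Require Import all_classical all_reals all_analysis.
From mathcomp Require Import measurable_realfun zify ring lra.
Import Order.TTheory GRing.Theory Num.Theory.
Import numFieldNormedType.Exports.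
Local Open Scope classical_set_scope.
Local Open Scope ring_scope.

Set Implicit Arguments.
Unset Strict Implicit.
Unset Printing Implicit Defensive.

(** * Lebesgue measure of discs *)

(** Packed as a measure structure so that the general lemmas on measures apply; it is convertible to
    the measure used in [area]. *)
Definition lebesgue2 (R : realType) :
    {measure set (measurableTypeR R * measurableTypeR R)%type -> \bar R} :=
  (@lebesgue_measure R \x @lebesgue_measure R)%E.

(** [M] is the squared radius, which keeps square roots out of the inclusions. *)
Definition disc (R : realType) (M : R) : set (R * R) :=
  [set X | dot X X <= M].

Lemma measurable_dot (R : realType) (u : R * R) :
  measurable_fun [set: R * R] (fun X => dot X u).
Proof.
by apply: measurable_funD; apply: measurable_funM;
  solve [exact: measurable_cst | exact: measurable_fst | exact: measurable_snd].
Qed.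

Lemma measurable_disc (R : realType) (M : R) : measurable (disc M).
Proof.
have mdot : measurable_fun [set: R * R] (fun X => dot X X).
  by apply: measurable_funD; apply: measurable_funM;
    solve [exact: measurable_fst | exact: measurable_snd].
have := mdot measurableT `]-oo, M]%classic (measurable_itv _).
rewrite setTI; congr measurable.
Qed.

Lemma is_derive_continuous (R : realType) (f f' : R -> R) :
  (forall x : R, is_derive x (1 : R) f (f' x)) -> continuous f.
Proof.
move=> df x; apply: differentiable_continuous; apply/derivable1_diffP.
exact: ex_derive.
Qed.

(** Substituting [x = r sin y] turns the integrand into [2 r^2 cos^2 y], with antiderivative
    [r^2 (y + sin y cos y)]. *)
Lemma integral_half_disc (R : realType) (r : R) : 0 < r ->
  (\int[lebesgue_measure]_(x in `[(- r)%R, r]%classic)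
    (2 * Num.sqrt (r ^+ 2 - x ^+ 2))%:E)%E = (pi * r ^+ 2)%:E.
Proof.
move=> r0.
pose F (x : R) := r * sin x.
pose G (x : R) := 2 * Num.sqrt (r ^+ 2 - x ^+ 2).
have pi0 := pi_gt0 R.
have dF (x : R) : is_derive x (1 : R) F (r * cos x).
  by apply: is_deriveZ.
have dFE : F^`()%classic = (fun x => r * cos x).
  by apply/funext => x; rewrite derive1E; apply: derive_val.
have cF := is_derive_continuous dF.
have cF' : continuous (fun x : R => r * cos x).
  have d (x : R) : is_derive x (1 : R) (fun x => r * cos x) (r * - sin x).
    exact: (@is_deriveZ _ _ _ (@cos R) r x 1 (- sin x) _).
  exact: (is_derive_continuous d).
have cG : continuous G.
  move=> x; apply: cvgM; first exact: cvg_cst.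
  apply: continuous_cvg; first exact: sqrt_continuous.
  apply: cvgB; first exact: cvg_cst.
  exact: exprn_continuous.
have FN : F (- (pi / 2)) = - r by rewrite /F sinN sin_pihalf mulrN mulr1.
have FP : F (pi / 2) = r by rewrite /F sin_pihalf mulr1.
rewrite -[X in `[_, X]%classic]FP -[X in `[X, _]%classic]FN.
rewrite (@integration_by_substitution_increasing _ F G); first last.
- exact: continuous_subspaceT.
- split.
  + by move=> x _; apply: ex_derive.
  + by apply: cvg_at_right_filter; apply: cF.
  + by apply: cvg_at_left_filter; apply: cF.
- by rewrite dFE; apply/cvg_ex; eexists; apply: cvg_at_left_filter; apply: cF'.
- by rewrite dFE; apply/cvg_ex; eexists; apply: cvg_at_right_filter; apply: cF'.
- by rewrite dFE => x _; apply: cF'.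
- move=> x y xI yI xy; rewrite /F ltr_pM2l //.
  by rewrite (ltr_sin xI yI).
- lra.
rewrite dFE.
pose H (x : R) := r ^+ 2 * (x + sin x * cos x).
have dH (x : R) : is_derive x (1 : R) H (r ^+ 2 * (1 + (sin x * - sin x + cos x * cos x))).
  by apply: is_deriveZ.
have cH := is_derive_continuous dH.
transitivity ((H (pi / 2))%:E - (H (- (pi / 2)))%:E)%E; last first.
  rewrite /H sinN cosN cos_pihalf -EFinB; congr EFin; lra.
pose K (x : R) := r ^+ 2 * (1 + (sin x * - sin x + cos x * cos x)).
rewrite -(@continuous_FTC2 _ K); first last.
- by move=> x _; rewrite derive1E; apply: derive_val.
- split.
  + by move=> x _; apply: ex_derive.
  + by apply: cvg_at_right_filter; apply: cH.
  + by apply: cvg_at_left_filter; apply: cH.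
- apply: continuous_subspaceT => x.
  apply: cvgM; first exact: cvg_cst.
  apply: cvgD; first exact: cvg_cst.
  apply: cvgD; apply: cvgM; try exact: continuous_cos.
    exact: continuous_sin.
  by apply: cvgN; exact: continuous_sin.
- lra.
apply: eq_integral => x; rewrite inE /= in_itv /= => xI; congr EFin.
have cx : 0 <= cos x by apply: cos_ge0_pihalf.
rewrite /G /F /K fctE /=.
have -> : r ^+ 2 - (r * sin x) ^+ 2 = (r * cos x) ^+ 2.
  by rewrite exprMn sin2cos2 exprMn; ring.
rewrite sqrtr_sqr ger0_norm; last by apply: mulr_ge0 => //; exact: ltW.
have := sin2cos2 x; rewrite expr2 => s2.
rewrite mulrN s2; ring.
Qed.

(** The section at abscissa [x] is an interval of length [2 sqrt (r^2 - x^2)] if [|x| <= r], and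
    empty otherwise. *)
Lemma lebesgue2_disc (R : realType) (r : R) : 0 < r ->
  lebesgue2 R (disc (r ^+ 2)) = (pi * r ^+ 2)%:E.
Proof.
move=> r0; rewrite -integral_half_disc // /lebesgue2 /= /product_measure1 /=.
rewrite [RHS]integral_mkcond; apply: eq_integral => x _.
rewrite patchE; case: ifPn => [|]; rewrite ?notin_setE ?inE /= in_itv /=.
  move=> xr; have x2 : 0 <= r ^+ 2 - x ^+ 2 by nra.
  set s := Num.sqrt _.
  have s0 : 0 <= s by apply: sqrtr_ge0.
  have s2 : s ^+ 2 = r ^+ 2 - x ^+ 2 by rewrite sqr_sqrtr.
  have -> : xsection (disc (r ^+ 2)) x = `[(- s), s]%classic.
    apply/seteqP; split => y; rewrite xsectionE /disc /dot /= in_itv /=.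
      by move=> h; apply/andP; split; nra.
    by move=> /andP[h1 h2]; nra.
  rewrite lebesgue_measure_itv /= lte_fin; case: ifPn => h; congr EFin; lra.
move=> xr; have -> : xsection (disc (r ^+ 2)) x = set0.
  apply/seteqP; split => // y; rewrite xsectionE /disc /dot /= => h.
  by apply: xr; apply/andP; split; nra.
exact: measure0.
Qed.

Lemma lebesgue2_open_gt0 (R : realType) (A : set (R * R)) (X : R * R) :
  measurable A -> nbhs X A -> (0 < lebesgue2 R A)%E.
Proof.
move=> mA /nbhs_ballP[e /= e0 eA].
(* Balls of the max norm are open squares; halving the radius makes room for a closed one. *)
pose h := e / 2.
have h0 : 0 < h by rewrite /h; lra.
pose I (x : R) : set R := `[x - h, x + h]%classic.
pose B := I X.1 `*` I X.2.
have mB : measurable B by apply: measurableX; exact: measurable_itv.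
apply: (@lt_le_trans _ _ (lebesgue2 R B)).
  rewrite [X in (_ < X)%E](_ : _ = lebesgue_measure (I X.1) *
      lebesgue_measure (I X.2))%E; last first.
    by apply: (@product_measure1E _ _ _ _ R lebesgue_measure lebesgue_measure);
      exact: measurable_itv.
  rewrite !lebesgue_measure_itv /= !lte_fin !ifT; [|lra|lra].
  by rewrite -!EFinB -EFinM lte_fin; apply: mulr_gt0; lra.
apply: le_measure; rewrite ?inE //.
move=> [x y] [/=]; rewrite /I /= !in_itv /= => /andP[x1 x2] /andP[y1 y2].
rewrite /h in x1 x2 y1 y2.
by apply: eA; split; rewrite /ball /= /ball_ /= ltr_norml; apply/andP; split; lra.
Qed.

(** * The region enclosed by a convex polygon *)

Lemma dotDl (R : realType) (A B C : R * R) : dot (A + B) C = dot A C + dot B C.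
Proof. by rewrite /dot /=; ring. Qed.

Lemma dotZl (R : realType) (a : R) (A B : R * R) : dot (a *: A) B = a * dot A B.
Proof. by rewrite /dot /= /GRing.scale /=; ring. Qed.

Lemma dotC (R : realType) (A B : R * R) : dot A B = dot B A.
Proof. by rewrite /dot; ring. Qed.

Lemma dotDr (R : realType) (A B C : R * R) : dot C (A + B) = dot C A + dot C B.
Proof. by rewrite !(dotC C) dotDl. Qed.

Lemma dotZr (R : realType) (a : R) (A B : R * R) : dot B (a *: A) = a * dot B A.
Proof. by rewrite !(dotC B) dotZl. Qed.

Lemma dot_ge0 (R : realType) (A : R * R) : 0 <= dot A A.
Proof. by rewrite /dot -!expr2 addr_ge0 ?sqr_ge0. Qed.

(** Takes the place of the Cauchy-Schwarz inequality in the norm estimates below. *)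
Lemma dot_le (R : realType) (A B : R * R) : dot A B *+ 2 <= dot A A + dot B B.
Proof.
have := dot_ge0 (A - B).
have -> : dot (A - B) (A - B) = dot A A + dot B B - dot A B *+ 2.
  by rewrite /dot /=; ring.
by rewrite subr_ge0.
Qed.

Lemma continuous_dotl (R : realType) (u : R * R) :
  continuous (fun X : R * R => dot X u).
Proof.
move=> X; apply: cvgD; apply: cvgM; try exact: cvg_cst.
  exact: cvg_fst.
exact: cvg_snd.
Qed.

Lemma continuous_dot (R : realType) : continuous (fun X : R * R => dot X X).
Proof.
move=> X; apply: cvgD; apply: cvgM; solve [exact: cvg_fst | exact: cvg_snd].
Qed.

Lemma near_dotl_lt (R : realType) (u X : R * R) (c : R) :
  dot X u < c -> \forall Y \near X, dot Y u < c.
Proof.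
move=> h.
exact: (@cvgr_lt _ _ _ _ (fun Y => dot Y u) _ (@continuous_dotl _ u X) _ h).
Qed.

Lemma near_dotl_gt (R : realType) (u X : R * R) (c : R) :
  c < dot X u -> \forall Y \near X, c < dot Y u.
Proof.
move=> h.
exact: (@cvgr_gt _ _ _ _ (fun Y => dot Y u) _ (@continuous_dotl _ u X) _ h).
Qed.

Lemma fine_lebesgue2_disc (R : realType) (r : R) : 0 < r ->
  fine (lebesgue2 R (disc (r ^+ 2))) = pi * r ^+ 2.
Proof. by move=> r0; rewrite lebesgue2_disc. Qed.

Lemma lebesgue2_fin_num (R : realType) (r : R) (A : set (R * R)) : 0 < r ->
  measurable A -> A `<=` disc (r ^+ 2) -> lebesgue2 R A \is a fin_num.
Proof.
move=> r0 mA AD; rewrite ge0_fin_numE; last exact: measure_ge0.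
apply: (@le_lt_trans _ _ (lebesgue2 R (disc (r ^+ 2)))).
  by apply: le_measure; rewrite ?inE //; exact: measurable_disc.
by rewrite lebesgue2_disc // ltry.
Qed.

Lemma fine_lebesgue2_le (R : realType) (r : R) (A B : set (R * R)) : 0 < r ->
  measurable A -> measurable B -> A `<=` B -> B `<=` disc (r ^+ 2) ->
  fine (lebesgue2 R A) <= fine (lebesgue2 R B).
Proof.
move=> r0 mA mB AB BD; apply: fine_le.
- exact: (lebesgue2_fin_num r0 mA (subset_trans AB BD)).
- exact: (lebesgue2_fin_num r0 mB BD).
- by apply: le_measure; rewrite ?inE.
Qed.

(** [B] splits into [A] and the difference, which has positive measure because it contains a
    neighbourhood of [X]. *)
Lemma fine_lebesgue2_lt (R : realType) (r : R) (A B : set (R * R)) (X : R * R) :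
  0 < r -> measurable A -> measurable B -> A `<=` B -> B `<=` disc (r ^+ 2) ->
  nbhs X (B `\` A) -> fine (lebesgue2 R A) < fine (lebesgue2 R B).
Proof.
move=> r0 mA mB AB BD XBA.
have mBA : measurable (B `\` A) by exact: measurableD.
have finA := lebesgue2_fin_num r0 mA (subset_trans AB BD).
have finB := lebesgue2_fin_num r0 mB BD.
have finD : lebesgue2 R (B `\` A) \is a fin_num.
  by apply: (lebesgue2_fin_num r0 mBA); apply: subset_trans BD; exact: subDsetl.
have -> : lebesgue2 R B = (lebesgue2 R A + lebesgue2 R (B `\` A))%E.
  rewrite -measureU //; first by rewrite setDUK.
  by rewrite setDIK.
rewrite (fineD finA finD) ltrDl -lte_fin (fineK finD).
exact: (lebesgue2_open_gt0 mBA XBA).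
Qed.

Section ConvexPolygon.
Context {R : realType} {n : nat} (V u : 'I_n -> R * R) (c : 'I_n -> R).
(** [u i] is an outer normal of edge [i], which lies on the line [dot X (u i) = c i]. [vertex_le]
    expresses convexity, [c_gt0] puts the origin strictly inside, and [sector] says that the cones
    over the edges cover the plane, so that the edges surround the origin. *)
Context (c_gt0 : forall i, 0 < c i)
  (edgeV : forall i, dot (V i) (u i) = c i)
  (edgeVS : forall i, dot (V (ordS i)) (u i) = c i)
  (vertex_le : forall i j, dot (V j) (u i) <= c i)
  (sector : forall X : R * R, exists j (a b : R),
     [/\ 0 <= a, 0 <= b & X = a *: V j + b *: V (ordS j)]).

Let K : set (R * R) := [set X | forall i, dot X (u i) <= c i].

(** Pairing [X] with [u j] gives [(a + b) c j <= c j]: the point lies in the triangle of the origin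
    and edge [j]. *)
Lemma sector_le1 X : K X -> exists j (a b : R),
  [/\ 0 <= a, 0 <= b, a + b <= 1 & X = a *: V j + b *: V (ordS j)].
Proof.
move=> KX; have [j [a [b [a0 b0 XE]]]] := sector X.
exists j, a, b; split => //.
have := KX j; rewrite XE dotDl !dotZl edgeV edgeVS -mulrDl.
by rewrite -[X in _ <= X -> _]mul1r ler_pM2r.
Qed.

Lemma boundaryE :
  polygon_boundary V = [set X | K X /\ exists i, dot X (u i) = c i].
Proof.
apply/seteqP; split => X.
  move=> [i _ [s /=]]; rewrite in_itv /= => /andP[s0 s1] <-; split; last first.
    by exists i; rewrite dotDl !dotZl edgeV edgeVS; ring.
  move=> j; rewrite dotDl !dotZl.
  have := vertex_le j i; have := vertex_le j (ordS i); nra.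
move=> [KX [i Xi]]; have [j [a [b [a0 b0 ab1 XE]]]] := sector_le1 KX.
(* By convexity the tight constraint [i] gives [c i <= (a + b) c i], so [a + b = 1] and [X] is on
   edge [j]. *)
have ab : a = 1 - b.
  move: Xi; rewrite XE dotDl !dotZl.
  have := vertex_le i j; have := vertex_le i (ordS j); have := c_gt0 i.
  move=> ? ? ? ?; apply: le_anti; apply/andP; split; first lra.
  rewrite leNgt; apply/negP => h; nra.
exists j => //; exists b; first by rewrite /= in_itv /=; apply/andP; split; lra.
by rewrite XE ab.
Qed.

Lemma interiorK X : K X -> ~ polygon_boundary V X -> forall i, dot X (u i) < c i.
Proof.
move=> KX nB i; rewrite lt_neqAle KX andbT; apply/eqP => h.
by apply: nB; rewrite boundaryE; split => //; exists i.
Qed.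

Lemma open_interiorK : open [set X | forall i, dot X (u i) < c i].
Proof.
rewrite openE => X /= XK.
have near_i i : nbhs X (fun Y => dot Y (u i) < c i) by exact: near_dotl_lt (XK i).
exact: (@filter_forall _ _ _ (nbhs X) _ near_i).
Qed.

Lemma closedK : closed K.
Proof.
have -> : K = \bigcap_(i in [set: 'I_n]) [set X | dot X (u i) <= c i].
  by apply/seteqP; split => X h i; [move=> _|]; exact: h.
apply: closed_bigI => i _.
exact: (proj1 (continuous_closedP _) (@continuous_dotl _ (u i)) _ (@closed_le _ (c i))).
Qed.

Lemma measurableK : measurable K.
Proof.
have -> : K = \bigcap_(i in [set: 'I_n]) [set X | dot X (u i) <= c i].
  by apply/seteqP; split => X h i; [move=> _|]; exact: h.
apply: fin_bigcap_measurable => [|i _]; first exact: finite_finset.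
have mdot : measurable_fun [set: R * R] (fun X => dot X (u i)) :=
  measurable_dot _.
have := mdot measurableT `]-oo, c i]%classic (measurable_itv _).
rewrite setTI; congr measurable.
Qed.

Lemma K_sub_disc M : (forall j, dot (V j) (V j) <= M) -> K `<=` disc M.
Proof.
move=> VM X /sector_le1[j [a [b [a0 b0 ab1 ->]]]]; rewrite /disc /=.
have M0 : 0 <= M := le_trans (dot_ge0 (V j)) (VM j).
have h := dot_le (V j) (V (ordS j)); have h1 := VM j; have h2 := VM (ordS j).
rewrite dotDl !dotZl !dotDr !dotZr (dotC (V (ordS j)) (V j)).
have ab : dot (V j) (V (ordS j)) <= M by lra.
apply: (@le_trans _ _ ((a + b) ^+ 2 * M)); last first.
  by rewrite -[leRHS]mul1r ler_wpM2r // expr_le1 // addr_ge0.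
have a2 : a ^+ 2 * dot (V j) (V j) <= a ^+ 2 * M by rewrite ler_wpM2l // sqr_ge0.
have b2 : b ^+ 2 * dot (V (ordS j)) (V (ordS j)) <= b ^+ 2 * M.
  by rewrite ler_wpM2l // sqr_ge0.
have ab2 : a * b * dot (V j) (V (ordS j)) <= a * b * M.
  by rewrite ler_wpM2l // mulr_ge0.
lra.
Qed.

Lemma bounded_K : bounded_set K.
Proof.
pose M := \sum_j dot (V j) (V j).
have VM j : dot (V j) (V j) <= M.
  by rewrite /M (bigD1 j) //= lerDl sumr_ge0 // => i _; exact: dot_ge0.
(* Each coordinate has square at most [M], and [M < (M + 1)^2] for [M >= 0]. *)
exists (M + 1); split; first exact: num_real.
move=> N MN X /(K_sub_disc VM); rewrite /disc /dot /= => h.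
by rewrite prod_normE ge_max !ler_norml; apply/andP; split; apply/andP; split; nra.
Qed.

Lemma component_K X : K X -> ~ polygon_boundary V X ->
  connected_component (~` polygon_boundary V) X `<=` K.
Proof.
set A := connected_component _ _ => KX nB.
have AX : A X by exact: connected_component_refl.
have cA : connected A by exact: component_connected.
(* A nonempty relatively clopen subset of a connected set is everything; on [A], the closed [K]
   agrees with the open set of strict inequalities. *)
have <- : A `&` K = A; last by move=> Y [].
apply: cA; first by exists X.
- exists [set X | forall i, dot X (u i) < c i]; first exact: open_interiorK.
  apply/seteqP; split => Y [AY KY]; split => //.
    exact/interiorK/(connected_component_sub AY).
  by move=> i; apply: ltW; exact: KY.
- by exists K => //; exact: closedK.
Qed.

Lemma component_unbounded X : ~ K X ->
  ~ bounded_set (connected_component (~` polygon_boundary V) X).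
Proof.
move=> /existsNP[i /negP]; rewrite -ltNge => Xi.
(* As [c i > 0], multiplying by [s >= 1] keeps constraint [i] violated. *)
pose ray : set (R * R) := (fun s : R => s *: X) @` `[1, +oo[%classic.
have rayB : ray `<=` ~` polygon_boundary V.
  move=> Y [s /=]; rewrite in_itv /= andbT => s1 <-{Y}.
  rewrite boundaryE => -[/(_ i) + _].
  rewrite dotZl; have := c_gt0 i; nra.
have rayX : ray X.
  by exists 1; rewrite ?scale1r //= in_itv /= andbT.
have crange : connected ray.
  apply: connected_continuous_connected.
    by apply/connected_intervalP; exact: interval_is_interval.
  by apply: continuous_subspaceT; exact: scalel_continuous.
have rayA := connected_component_max rayX rayB crange.
move=> -[M [_ bM]].
have X0 : 0 < `|X|.
  rewrite normr_gt0; apply/eqP => X0; move: Xi; rewrite X0 /dot /= !mul0r addr0.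
  by apply/negP; rewrite -leNgt ltW.
have := bM (`|M| + 1).
have M1 : M < `|M| + 1 by have := ler_norm M; lra.
(* Then [s *: X] has norm [|M| + 1 + |X|], beyond the supposed bound [|M| + 1]. *)
pose s := (`|M| + 1) / `|X| + 1.
have s1 : 1 < s by rewrite /s ltrDr divr_gt0 // ltr_wpDl.
move=> /(_ M1 (s *: X)) h.
have /h : connected_component (~` polygon_boundary V) X (s *: X).
  by apply: rayA; exists s => //=; rewrite in_itv /= andbT ltW.
rewrite /= normrZ ger0_norm; last lra.
rewrite /s mulrDl mul1r divfK ?gt_eqF //; lra.
Qed.

Lemma polygon_regionE : polygon_region V = K.
Proof.
apply/seteqP; split => X.
  move=> [|[nB bX]]; first by rewrite boundaryE => -[].
  by apply: contrapT => /component_unbounded.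
move=> KX; have [|nB] := pselect (polygon_boundary V X); first by left.
right; split => //.
case: bounded_K => M [Mreal MK]; exists M; split => // N MN Y.
by move/(component_K KX nB); exact: MK.
Qed.

Lemma areaE : area V = fine (lebesgue2 R K).
Proof. by rewrite /area polygon_regionE. Qed.

Context (u1 : forall i, dot (u i) (u i) = 1).

(** [dot_le] applied to [X] and [m *: u i] gives [2 m dot X (u i) <= 2 m^2]. *)
Lemma disc_sub_K m : 0 < m -> (forall i, m <= c i) -> disc (m ^+ 2) `<=` K.
Proof.
move=> m0 mc X; rewrite /disc /= => Xm i; apply: le_trans (mc i).
have := dot_le X (m *: u i).
by rewrite dotZl !dotZr u1 => h; nra.
Qed.

(** The radius [r] ensures finite measure, which comparing values of [fine] requires. *)
Lemma area_ge m r : 0 < m -> (forall i, m <= c i) ->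
  0 < r -> (forall j, dot (V j) (V j) <= r ^+ 2) -> pi * m ^+ 2 <= area V.
Proof.
move=> m0 mc r0 Vr; rewrite areaE -(fine_lebesgue2_disc m0).
apply: (fine_lebesgue2_le r0); [exact: measurable_disc|exact: measurableK| |].
  exact: disc_sub_K.
exact: K_sub_disc.
Qed.

Lemma area_le r : 0 < r -> (forall j, dot (V j) (V j) <= r ^+ 2) ->
  area V <= pi * r ^+ 2.
Proof.
move=> r0 Vr; rewrite areaE -(fine_lebesgue2_disc r0).
apply: (fine_lebesgue2_le r0); [exact: measurableK|exact: measurable_disc| |].
  exact: K_sub_disc.
by [].
Qed.

Lemma area_lt r i : 0 < r -> (forall j, dot (V j) (V j) <= r ^+ 2) -> c i < r ->
  area V < pi * r ^+ 2.
Proof.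
move=> r0 Vr cr; rewrite areaE -(fine_lebesgue2_disc r0).
(* [s] lies strictly between [c i] and [r], so [s *: u i] is beyond edge [i] but still inside the
   disc. *)
pose s := (c i + r) / 2; have ci := c_gt0 i.
apply: (@fine_lebesgue2_lt _ r _ _ (s *: u i)) => //.
- exact: measurableK.
- exact: measurable_disc.
- exact: K_sub_disc.
have near_disc : nbhs (s *: u i) (fun Y => dot Y Y < r ^+ 2).
  apply: (@cvgr_lt _ _ _ _ (fun Y => dot Y Y) _ (@continuous_dot R _)).
  by rewrite dotZl dotZr u1 /s; nra.
have near_gap : nbhs (s *: u i) (fun Y => c i < dot Y (u i)).
  by apply: near_dotl_gt; rewrite dotZl u1 /s; lra.
apply: filterS2 near_disc near_gap => Y Yr Yc; split; first exact: ltW.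
by move=> /(_ i); rewrite leNgt Yc.
Qed.

Lemma area_gt m r j : 0 < m -> (forall i, m <= c i) ->
  0 < r -> (forall j, dot (V j) (V j) <= r ^+ 2) -> m ^+ 2 < dot (V j) (V j) ->
  pi * m ^+ 2 < area V.
Proof.
move=> m0 mc r0 Vr Vm; rewrite areaE -(fine_lebesgue2_disc m0).
(* The witness is [s *: V j] with [s < 1] interior to [K]; by AM-GM its squared
   norm [s ^+ 2 * q] still exceeds [m ^+ 2]. *)
set q := dot (V j) (V j) in Vm.
have q0 : 0 < q by nra.
pose s := (1 + m ^+ 2 / q) / 2.
have mq : m ^+ 2 / q < 1 by rewrite ltr_pdivrMr // mul1r.
have s0 : 0 < s by rewrite /s divr_gt0 // ltr_pwDl // divr_ge0 ?sqr_ge0 ?ltW.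
have s1 : s < 1 by rewrite /s; lra.
have sm : m ^+ 2 < s * (s * q).
  have -> : m ^+ 2 = (m ^+ 2 / q) * q by rewrite divfK ?gt_eqF.
  rewrite mulrA ltr_pM2r // /s; nra.
apply: (@fine_lebesgue2_lt _ r _ _ (s *: V j)) => //.
- exact: measurable_disc.
- exact: measurableK.
- exact: disc_sub_K.
- exact: K_sub_disc.
have near_K : nbhs (s *: V j) [set Y | forall i, dot Y (u i) < c i].
  apply: open_nbhs_nbhs; split; first exact: open_interiorK.
  move=> i; rewrite dotZl; have := vertex_le i j; have := c_gt0 i; nra.
have near_gap : nbhs (s *: V j) (fun Y => m ^+ 2 < dot Y Y).
  apply: (@cvgr_gt _ _ _ _ (fun Y => dot Y Y) _ (@continuous_dot R _)).
  by rewrite dotZl dotZr.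
apply: filterS2 near_K near_gap => Y YK Ym; split.
  by move=> i; apply: ltW; exact: YK.
by rewrite /disc /= leNgt Ym.
Qed.
End ConvexPolygon.

(** * Points of the circle in counterclockwise order *)

Definition circle_pt (R : realType) (a : R) : R * R := (cos a, sin a).

Lemma dot_circle_pt (R : realType) (a b : R) :
  dot (circle_pt a) (circle_pt b) = cos (a - b).
Proof. by rewrite cosB. Qed.

Lemma dot_circle_ptxx (R : realType) (a : R) :
  dot (circle_pt a) (circle_pt a) = 1.
Proof. by rewrite dot_circle_pt subrr cos0. Qed.

Lemma circle_ptD2pi (R : realType) (a : R) : circle_pt (a + 2 * pi) = circle_pt a.
Proof. by rewrite /circle_pt (mulr_natl pi 2) cosD2pi sinD2pi. Qed.

(** The hypothesis keeps [x] at distance at least [h] from the multiples of [2 pi]; past [pi], the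
    reflection [y -> 2 pi - y] reduces to the range where [cos] decreases. *)
Lemma cos_le_cos_far (R : realType) (h x : R) :
  0 <= h <= pi -> h <= `|x| <= 2 * pi - h -> cos x <= cos h.
Proof.
move=> /andP[h0 hpi] /andP[hx xh]; rewrite -(cos_norm x); set y := `|x| in hx xh *.
have cos_anti (a b : R) : 0 <= a -> a <= b -> b <= pi -> cos b <= cos a.
  move=> a0 ab bpi; move: ab; rewrite le_eqVlt => /predU1P[->//|ab].
  by apply: ltW; rewrite ltr_cos // in_itv /=; apply/andP; split; lra.
have [ypi|piy] := leP y pi; first exact: cos_anti.
have -> : cos y = cos (2 * pi - y).
  by rewrite -(cosN y) -(cosD2pi (- y)) mulr_natl addrC.
by apply: cos_anti; lra.
Qed.

Lemma polar (R : realType) (a : R) (X : R * R) : exists (r x : R),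
  [/\ 0 <= r, a <= x <= a + 2 * pi & X = r *: circle_pt x].
Proof.
pose r := Num.sqrt (dot X X).
have r2 : r ^+ 2 = dot X X by rewrite sqr_sqrtr // dot_ge0.
have [r0|r0] := eqVneq r 0.
  exists 0, a; split => //; first by have := pi_gt0 R; lra.
  move: r2; rewrite r0 /dot => h; rewrite scale0r.
  case: X h {r r0} => x y /= h.
  have x0 : x = 0 by apply/eqP; rewrite -sqrf_eq0; apply/eqP; nra.
  have y0 : y = 0 by apply/eqP; rewrite -sqrf_eq0; apply/eqP; nra.
  by rewrite x0 y0.
have rgt0 : 0 < r by rewrite lt_neqAle eq_sym r0 sqrtr_ge0.
(* [c] and [s] are the coordinates of [X / r] in the frame rotated by [a], so that the angle is
   measured from [a]. *)
pose c := dot X (circle_pt a) / r.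
pose s := dot X (circle_pt (a + pi / 2)) / r.
have cs : c ^+ 2 + s ^+ 2 = 1.
  have -> : c ^+ 2 + s ^+ 2 =
      dot X X * (cos a ^+ 2 + sin a ^+ 2) / r ^+ 2.
    by rewrite /c /s /dot /= cosDpihalf sinDpihalf; field.
  by rewrite cos2Dsin2 mulr1 -r2 divff // expf_neq0.
have XE (y : R) : cos y = c -> sin y = s -> X = r *: circle_pt (a + y).
  move=> cy sy; rewrite /circle_pt cosD sinD cy sy /c /s /dot /= cosDpihalf sinDpihalf.
  have h := cos2Dsin2 a; case: (X) => x1 x2; congr pair => /=.
    transitivity (x1 * (cos a ^+ 2 + sin a ^+ 2)); first by rewrite h mulr1.
    by rewrite /GRing.scale /=; field.
  transitivity (x2 * (cos a ^+ 2 + sin a ^+ 2)); first by rewrite h mulr1.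
  by rewrite /GRing.scale /=; field.
have c1 : -1 <= c <= 1 by apply/andP; split; nra.
have pi0 := pi_gt0 R.
have cacos : cos (acos c) = c by rewrite acosK // in_itv.
have a0 := acos_ge0 c1; have api := acos_lepi c1.
have sacos : sin (acos c) = `|s|.
  rewrite sin_acos // -sqrtr_sqr; congr Num.sqrt; lra.
(* [acos c] has sine [|s|]; for negative [s] the angle [2 pi - acos c] is the right one. *)
have [s0|s0] := leP 0 s.
  exists r, (a + acos c); split; [exact: ltW|lra|].
  by apply: XE => //; rewrite sacos ger0_norm.
exists r, (a + (- acos c + 2 * pi)); split; [exact: ltW|lra|].
rewrite addrA circle_ptD2pi; apply: XE; first by rewrite cosN.
by rewrite sinN sacos ltr0_norm ?opprK.
Qed.

(** The condition on angles in [is_circuit], detached from the points so that it also applies to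
    vertices off the circle. *)
Definition angular_steps (R : realType) (n : nat) (t : nat -> R) :=
  t n = t 0%N + 2 * pi /\ forall i, (i < n)%N -> 0 < t i.+1 - t i < pi.

Section AngularSteps.
Context {R : realType} (n : nat) (t : nat -> R) (tP : angular_steps n t).

Let tn : t n = t 0%N + 2 * pi. Proof. exact: tP.1. Qed.
Let dt i : (i < n)%N -> 0 < t i.+1 - t i < pi. Proof. exact: tP.2. Qed.

Lemma steps_gt0 : (0 < n)%N.
Proof. by case: n tn => // h; have := pi_gt0 R; lra. Qed.

Lemma steps_mono i j : (i <= j <= n)%N -> t i <= t j.
Proof.
elim: j => [|j IH]; first by rewrite andbT leqn0 => /eqP ->.
rewrite leq_eqVlt => /andP[/predU1P[->//|ij] jn].
apply: le_trans (IH _) _; first by rewrite -ltnS ij ltnW.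
by have := dt jn; lra.
Qed.

(** At the last index [ordS] wraps to 0 whereas [t] goes on to [t n]; the two angles differ by
    [2 pi]. *)
Lemma circle_pt_ordS (i : 'I_n) : circle_pt (t (ordS i)) = circle_pt (t i.+1).
Proof.
rewrite /=; have := ltn_ord i; rewrite leq_eqVlt => /predU1P[->|h].
  by rewrite modnn tn circle_ptD2pi.
by rewrite modn_small.
Qed.

(** For the chord from [t i] to [t i.+1], [circle_pt (mid_angle i)] is the unit normal and
    [cos (half_arc i)] the distance from the origin. *)
Definition half_arc (i : nat) : R := (t i.+1 - t i) / 2.
Definition mid_angle (i : nat) : R := (t i + t i.+1) / 2.

Lemma half_arc_bounds i : (i < n)%N -> 0 < half_arc i < pi / 2.
Proof. by move=> /dt; rewrite /half_arc; lra. Qed.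

Lemma cos_half_arc_gt0 i : (i < n)%N -> 0 < cos (half_arc i).
Proof.
move=> /half_arc_bounds h; apply: cos_gt0_pihalf; lra.
Qed.

Lemma cos_half_arc_lt1 i : (i < n)%N -> cos (half_arc i) < 1.
Proof.
move=> /half_arc_bounds h; rewrite -cos0 ltr_cos ?in_itv /= ?lexx ?pi_ge0 //; lra.
Qed.

(** No [t j] falls inside the open arc from [t i] to [t i.+1], so each stays at least [half_arc i]
    away from its midpoint. This yields convexity of both polygons. *)
Lemma cos_sub_mid_le i j : (i < n)%N -> (j < n)%N ->
  cos (t j - mid_angle i) <= cos (half_arc i).
Proof.
move=> ilt jlt; have /andP[h0 h1] := half_arc_bounds ilt; have pi0 := pi_gt0 R.
have t0j : t 0%N <= t j by apply: steps_mono; rewrite leq0n ltnW.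
have tjn : t j <= t n by apply: steps_mono; rewrite leqnn ltnW.
have t0i : t 0%N <= t i by apply: steps_mono; rewrite leq0n ltnW.
have tin : t i.+1 <= t n by apply: steps_mono; rewrite leqnn andbT.
have t0n := tn.
apply: cos_le_cos_far; first lra.
have [ji|ij] := leqP j i.
  have tji : t j <= t i by apply: steps_mono; rewrite ji ltnW.
  rewrite /half_arc /mid_angle in h0 h1 *; rewrite ler0_norm; lra.
have tij : t i.+1 <= t j by apply: steps_mono; rewrite ij ltnW.
rewrite /half_arc /mid_angle in h0 h1 *; rewrite ger0_norm; lra.
Qed.

Lemma steps_cover k x : (0 < k)%N -> t 0%N <= x <= t k ->
  exists2 i, (i < k)%N & t i <= x <= t i.+1.
Proof.
elim: k => // k IH _ /andP[x0 xk].
case: (posnP k) => [k0|k0]; first by exists k => //; rewrite xk k0 x0.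
have [xle|xgt] := leP x (t k).
  by have [i ik ix] := IH k0 (introT andP (conj x0 xle)); exists i => //; exact: ltnW.
by exists k => //; rewrite xk ltW.
Qed.

(** With [e = circle_pt] and [x] between [p = t i] and [q = t i.+1], [sin (q - p) e(x) = sin (q - x)
    e(p) + sin (x - p) e(q)], and the sines are nonnegative since [q - p < pi]. The weights [w]
    allow vertices off the circle. *)
Lemma sector_steps (w : 'I_n -> R) (X : R * R) : (forall i, 0 < w i) ->
  exists j (a b : R), [/\ 0 <= a, 0 <= b &
    X = a *: (w j *: circle_pt (t j)) + b *: (w (ordS j) *: circle_pt (t (ordS j)))].
Proof.
move=> w0; have [r [x [r0 xt ->]]] := polar (t 0%N) X.
have [|i ilt /andP[x1 x2]] := @steps_cover n x steps_gt0; first by rewrite tn.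
pose j : 'I_n := Ordinal ilt.
have /andP[d0 d1] := dt ilt.
have sd : 0 < sin (t i.+1 - t i) by rewrite sin_gt0_pi // d0.
have sx1 : 0 <= sin (x - t i) by rewrite sin_ge0_pi //; lra.
have sx2 : 0 <= sin (t i.+1 - x) by rewrite sin_ge0_pi //; lra.
exists j, (r * sin (t i.+1 - x) / sin (t i.+1 - t i) / w j),
  (r * sin (x - t i) / sin (t i.+1 - t i) / w (ordS j)); split.
- by apply: divr_ge0; [apply: divr_ge0; [exact: mulr_ge0|exact: ltW]|exact: ltW].
- by apply: divr_ge0; [apply: divr_ge0; [exact: mulr_ge0|exact: ltW]|exact: ltW].
rewrite circle_pt_ordS -[t j]/(t i) -[t j.+1]/(t i.+1) !scalerA !divfK ?gt_eqF // /circle_pt /GRing.scale /=.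
move: sd; rewrite !sinB => sd.
by congr pair; rewrite /= /GRing.scale /=; field; rewrite gt_eqF.
Qed.

(* The polar angles of the vertices of the circumscribed polygon are again those
   of a circuit, so [sector_steps] applies to them. *)
Lemma steps_mid : angular_steps n
  (fun i => if (i < n)%N then mid_angle i else mid_angle 0 + 2 * pi).
Proof.
have n0 := steps_gt0; split; first by rewrite ltnn n0.
move=> i ilt; rewrite ilt; have di := dt ilt; have d0 := dt n0; have t0n := tn.
rewrite /mid_angle; case: ifPn => [i1|]; first by have := dt i1; lra.
rewrite -leqNgt => ni; have e : i.+1 = n by apply/eqP; rewrite eqn_leq ilt.
by rewrite e in di *; lra.
Qed.

End AngularSteps.

(** * Regular polygons and [circle_pi] *)

Lemma circle_ptD_eq (R : realType) (a b s : R) :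
  circle_pt a = circle_pt b -> circle_pt (a + s) = circle_pt (b + s).
Proof. by move=> [ca sa]; rewrite /circle_pt !cosD !sinD ca sa. Qed.

Lemma dot_circle_sub (R : realType) (m h : R) (D := circle_pt (m - h) - circle_pt (m + h)) :
  dot D D = (2 * sin h) ^+ 2.
Proof.
transitivity ((2 * sin h) ^+ 2 * (cos m ^+ 2 + sin m ^+ 2)).
  by rewrite /D /dot /= cosB cosD sinB sinD; ring.
by rewrite cos2Dsin2 mulr1.
Qed.

Lemma edist_circle_pt (R : realType) (a b : R) : a <= b <= a + 2 * pi ->
  Defs.edist (circle_pt a) (circle_pt b) = 2 * sin ((b - a) / 2).
Proof.
move=> ab; have s0 : 0 <= sin ((b - a) / 2) by apply: sin_ge0_pi; lra.
rewrite -[RHS]ger0_norm; last by rewrite mulr_ge0.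
rewrite -sqrtr_sqr /Defs.edist; congr Num.sqrt.
have := dot_circle_sub ((a + b) / 2) ((b - a) / 2).
have -> : (a + b) / 2 - (b - a) / 2 = a by field.
by have -> : (a + b) / 2 + (b - a) / 2 = b by field.
Qed.

Lemma telescope_half_arc (R : realType) (n : nat) (t : nat -> R) :
  \sum_(i < n) half_arc t i = (t n - t 0%N) / 2.
Proof.
by rewrite -(telescope_sumr t (leq0n n)) big_mkord mulr_suml.
Qed.

Lemma edge_length_circuit (R : realType) (n : nat) (t : nat -> R)
    (P : 'I_n -> R * R) : angular_steps n t ->
  (forall i : 'I_n, P i = circle_pt (t i)) ->
  forall i : 'I_n, edge_length P i = 2 * sin (half_arc t i).
Proof.
move=> tP PE i; rewrite /edge_length !PE circle_pt_ordS // edist_circle_pt //.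
by have := tP.2 i (ltn_ord i); have := pi_gt0 R; lra.
Qed.

(** [sin] is injective on the range of half-arcs, so equal edges force equal half-arcs, and these
    add up to [pi]. *)
Lemma regular_perimeter (R : realType) (n : nat) (P : 'I_n -> R * R) :
  is_circuit P -> (forall i j, edge_length P i = edge_length P j) ->
  perimeter P = n%:R * (2 * sin (pi / n%:R)).
Proof.
move=> [t [tn dt PE]] ed; have tP : angular_steps n t by split.
have n0 := steps_gt0 tP; pose i0 := Ordinal n0.
have EL := edge_length_circuit tP PE.
have hE (i : 'I_n) : half_arc t i = half_arc t i0.
  have hi := half_arc_bounds tP (ltn_ord i).
  have hi0 := half_arc_bounds tP (ltn_ord i0).
  apply: sin_inj; rewrite ?in_itv /=; [lra|lra|].
  by have := ed i i0; rewrite !EL; lra.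
have h0 : half_arc t i0 = pi / n%:R.
  have := telescope_half_arc n t; rewrite (eq_bigr _ (fun i _ => hE i)).
  rewrite sumr_const card_ord tn => h.
  have nn : (n%:R : R) != 0 by rewrite pnatr_eq0 -lt0n.
  by apply: (mulfI nn); rewrite mulr_natl h; field.
rewrite /perimeter (eq_bigr (fun=> 2 * sin (pi / n%:R))).
  by rewrite sumr_const card_ord [RHS]mulr_natl.
by move=> i _; rewrite EL hE h0.
Qed.

(** Equally spaced points; [n > 2] makes each step [2 pi / n] less than [pi]. This makes the set in
    [p3] nonempty. *)
Lemma regular_circuit_exists (R : realType) (n : nat) : (2 < n)%N ->
  exists2 P : 'I_n -> R * R, is_circuit P & regular_polygon P.
Proof.
move=> n2; pose s : R := 2 * pi / n%:R; pose t (i : nat) : R := i%:R * s.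
pose P (i : 'I_n) := circle_pt (t i).
have n3 : (3 : R) <= n%:R by rewrite ler_nat.
have pi0 := pi_gt0 R.
have sn : n%:R * s = 2 * pi by rewrite /s mulrC divfK // gt_eqF //; lra.
have ts i : t i.+1 = t i + s by rewrite /t -natr1; ring.
have s0 : 0 < s by rewrite /s divr_gt0 //; lra.
have tP : angular_steps n t.
  split; first by rewrite /t mul0r add0r sn.
  by move=> i _; rewrite ts addrAC subrr add0r s0 /=; nra.
have PS (i : 'I_n) : P (ordS i) = circle_pt (t i + s).
  by rewrite /P circle_pt_ordS // ts.
have PSS (i : 'I_n) : P (ordS (ordS i)) = circle_pt (t i + s + s).
  by rewrite PS; apply: circle_ptD_eq; exact: PS.
have edE (a b : R) : a <= b <= a + 2 * pi -> Defs.edist (circle_pt b) (circle_pt a) =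
    2 * sin ((b - a) / 2).
  move=> ab; rewrite -edist_circle_pt // /Defs.edist -[in RHS]opprB; congr Num.sqrt.
  by rewrite /dot /=; ring.
exists P; first by exists t; split => //; [exact: tP.1|exact: tP.2].
split=> i j.
  by rewrite !(edge_length_circuit tP (fun=> erefl)) /half_arc !ts; congr (2 * sin _); ring.
rewrite /angle; congr acos.
(* The cosine of the angle depends on the step [s] alone, hence is the same at all vertices. *)
suff E (k : 'I_n) : dot (P k - P (ordS k)) (P (ordS (ordS k)) - P (ordS k)) /
    (Defs.edist (P k) (P (ordS k)) * Defs.edist (P (ordS (ordS k))) (P (ordS k))) =
    (cos (s + s) - 2 * cos s + 1) / ((2 * sin (s / 2)) ^+ 2).
  by rewrite !E.
have spi : s <= 2 * pi by nra.
rewrite PSS PS -[P k]/(circle_pt (t k)) edist_circle_pt; last lra.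
rewrite edE; last lra.
have -> : t k + s - t k = s by ring.
have -> : t k + s + s - (t k + s) = s by ring.
congr (_ / _).
have e : dot (circle_pt (t k) - circle_pt (t k + s))
    (circle_pt (t k + s + s) - circle_pt (t k + s)) =
    cos (t k - (t k + s + s)) - cos (t k - (t k + s))
    - cos ((t k + s) - (t k + s + s)) + cos ((t k + s) - (t k + s)).
  by rewrite -!dot_circle_pt /dot /=; ring.
rewrite e subrr cos0.
have -> : t k - (t k + s + s) = - (s + s) by ring.
have -> : t k - (t k + s) = - s by ring.
have -> : t k + s - (t k + s + s) = - s by ring.
by rewrite !cosN; ring.
Qed.

Lemma p3E (R : realType) (m : nat) :
  @p3 R m = (3 * 2 ^ m)%:R * (2 * sin (pi / (3 * 2 ^ m)%:R)).
Proof.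
have n2 : (2 < 3 * 2 ^ m)%N by have := expn_gt0 2 m; lia.
have [P cP rP] := @regular_circuit_exists R _ n2.
rewrite /p3; apply: get_unique.
  by exists P; split => //; rewrite regular_perimeter //; exact: rP.1.
by move=> p [Q [cQ rQ ->]]; rewrite regular_perimeter //; exact: rQ.1.
Qed.

Lemma cvg_sin_div (R : realType) : sin x / x @[x --> (0 : R)^'] --> (1 : R).
Proof.
have [dsin sin'0] := is_derive_sin (0 : R).
have := dsin; rewrite /derivable => h.
have : sin x / x @[x --> (0 : R)^'] --> 'D_1 sin (0 : R).
  have -> : (fun x : R => sin x / x) =
      (fun h : R => h^-1 *: (sin (h *: 1 + 0) - sin 0)).
    by apply/funext => x; rewrite sin0 subr0 addr0 /GRing.scale /= mulr1 mulrC.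
  exact: h.
by rewrite sin'0 cos0.
Qed.

Lemma cvg_p3 (R : realType) : @p3 R @ \oo --> 2 * pi.
Proof.
pose x (m : nat) : R := pi / (3 * 2 ^ m)%:R.
have N0 m : 0 < (3 * 2 ^ m)%:R :> R by rewrite ltr0n muln_gt0 /= expn_gt0.
have x0 m : x m != 0 by rewrite gt_eqF // divr_gt0 // pi_gt0.
have -> : @p3 R = fun m => 2 * pi * (sin (x m) / x m).
  apply/funext => m; rewrite p3E /x; have := N0 m; move: _%:R => N NN.
  have := pi_gt0 R; move: pi => p p0.
  by field; rewrite !gt_eqF.
suff : (fun m => 2 * pi * (sin (x m) / x m)) @ \oo --> (2 * pi * 1 : R).
  by rewrite mulr1.
apply: cvgM; first exact: cvg_cst.
have xcvg : x @ \oo --> (0 : R).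
  have -> : x = geometric (pi / 3) (2^-1).
    apply/funext => m; rewrite /x /geometric /= natrM natrX exprVn; field.
    by rewrite expf_neq0.
  by apply: cvg_geometric; rewrite ger0_norm //; lra.
have /cvgr_dnbhsP := @cvg_sin_div R.
by apply; split.
Qed.

Lemma circle_piE (R : realType) : @circle_pi R = pi.
Proof.
by rewrite /circle_pi (cvg_lim _ (@cvg_p3 R)) // mulrAC divff // mul1r.
Qed.

(** * Areas of the two polygons of a circuit *)

Lemma tangent_line_circle_pt (R : realType) (a : R) (X : R * R) :
  tangent_line (circle_pt a) X <-> dot X (circle_pt a) = 1.
Proof.
rewrite /tangent_line /= -(dot_circle_ptxx a) dotC /dot /=.
by split => h; lra.
Qed.

(** Cramer's rule for the two linear equations, whose determinant is [sin (b - a)]. *)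
Lemma dot_circle_pt_inj (R : realType) (a b : R) (X Y : R * R) :
  sin (b - a) != 0 ->
  dot X (circle_pt a) = dot Y (circle_pt a) ->
  dot X (circle_pt b) = dot Y (circle_pt b) -> X = Y.
Proof.
move=> s0 ha hb.
have e1 : sin (b - a) * X.1 = sin (b - a) * Y.1.
  transitivity (sin b * dot X (circle_pt a) - sin a * dot X (circle_pt b)).
    by rewrite sinB /dot /=; ring.
  by rewrite ha hb sinB /dot /=; ring.
have e2 : sin (b - a) * X.2 = sin (b - a) * Y.2.
  transitivity (cos a * dot X (circle_pt b) - cos b * dot X (circle_pt a)).
    by rewrite sinB /dot /=; ring.
  by rewrite ha hb sinB /dot /=; ring.
move: (mulfI s0 e1) (mulfI s0 e2).
by case: X Y {ha hb e1 e2} => [x1 x2] [y1 y2] /= -> ->.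
Qed.

Section CircuitAreas.
Context {R : realType} (n : nat) (t : nat -> R) (P : 'I_n -> R * R).
Context (tP : angular_steps n t)
  (PE : forall i : 'I_n, P i = circle_pt (t i)).

Let cos_gt0 (i : 'I_n) : 0 < cos (half_arc t i).
Proof. exact: (cos_half_arc_gt0 tP (ltn_ord i)). Qed.

Let cos_lt1 (i : 'I_n) : cos (half_arc t i) < 1.
Proof. exact: (cos_half_arc_lt1 tP (ltn_ord i)). Qed.

Let sub_mid (i : nat) : t i - mid_angle t i = - half_arc t i.
Proof. by rewrite /mid_angle /half_arc; field. Qed.

Let subS_mid (i : nat) : t i.+1 - mid_angle t i = half_arc t i.
Proof. by rewrite /mid_angle /half_arc; field. Qed.

Let PS (i : 'I_n) : P (ordS i) = circle_pt (t i.+1).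
Proof. by rewrite PE circle_pt_ordS. Qed.

(** Closed form of the intersection of the tangents at [t i] and [t i.+1], on the bisecting ray. *)
Let vertex (i : 'I_n) : R * R :=
  (cos (half_arc t i))^-1 *: circle_pt (mid_angle t i).

Let dot_vertex (i : 'I_n) (a : R) :
  dot (vertex i) (circle_pt a) = cos (a - mid_angle t i) / cos (half_arc t i).
Proof. by rewrite dotZl dotC dot_circle_pt mulrC. Qed.

Let vertex_P (i : 'I_n) : dot (vertex i) (circle_pt (t i)) = 1.
Proof. by rewrite dot_vertex sub_mid cosN divff // gt_eqF. Qed.

Let vertex_PS (i : 'I_n) : dot (vertex i) (circle_pt (t i.+1)) = 1.
Proof. by rewrite dot_vertex subS_mid divff // gt_eqF. Qed.

Lemma circumscribedE : circumscribed P = vertex.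
Proof.
apply/funext => i; rewrite /circumscribed PS PE; apply: get_unique.
  by split; apply/tangent_line_circle_pt.
move=> X [/tangent_line_circle_pt h1 /tangent_line_circle_pt h2].
apply: (@dot_circle_pt_inj _ (t i) (t i.+1)); rewrite ?h1 ?h2 ?vertex_P ?vertex_PS //.
by rewrite gt_eqF // sin_gt0_pi // (tP.2 i).
Qed.

(** Edge [i] has the direction of [mid_angle t i] as normal and offset [cos (half_arc t i)], which
    lies in [[m, 1)]. *)
Lemma inscribed_area_bounds m : 0 < m ->
  (forall i : 'I_n, m <= cos (half_arc t i)) ->
  pi * m ^+ 2 <= area (inscribed P) < pi.
Proof.
move=> m0 mc; pose u (i : 'I_n) := circle_pt (mid_angle t i).
pose i0 : 'I_n := Ordinal (steps_gt0 tP).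
have edgeP (i : 'I_n) : dot (P i) (u i) = cos (half_arc t i).
  by rewrite PE dot_circle_pt sub_mid cosN.
have edgePS (i : 'I_n) : dot (P (ordS i)) (u i) = cos (half_arc t i).
  by rewrite PS dot_circle_pt subS_mid.
have P_le (i j : 'I_n) : dot (P j) (u i) <= cos (half_arc t i).
  by rewrite PE dot_circle_pt; exact: (cos_sub_mid_le tP).
have sectorP (X : R * R) : exists j (a b : R),
    [/\ 0 <= a, 0 <= b & X = a *: P j + b *: P (ordS j)].
  have [j [a [b [a0 b0 ->]]]] := sector_steps tP X (fun=> @ltr01 R).
  by exists j, a, b; split => //; rewrite !PE !scale1r.
have u1 (i : 'I_n) : dot (u i) (u i) = 1 by exact: dot_circle_ptxx.
have P1 (i : 'I_n) : dot (P i) (P i) <= 1 ^+ 2.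
  by rewrite PE dot_circle_ptxx expr1n.
apply/andP; split.
  exact: (area_ge cos_gt0 edgeP edgePS P_le sectorP u1 m0 mc ltr01 P1).
have := area_lt cos_gt0 edgeP edgePS P_le sectorP u1 ltr01 P1 (cos_lt1 i0).
by rewrite expr1n mulr1.
Qed.

Lemma circumscribed_area_bounds m : 0 < m ->
  (forall i : 'I_n, m <= cos (half_arc t i)) ->
  pi < area (circumscribed P) <= pi * m ^- 2.
Proof.
move=> m0 mc; rewrite circumscribedE.
pose i0 : 'I_n := Ordinal (steps_gt0 tP).
(* Index shift: the edge from vertex [i] to vertex [ordS i] lies on the tangent at [P (ordS i)], the
   point common to both arcs. *)
have edgeV (i : 'I_n) : dot (vertex i) (P (ordS i)) = 1 by rewrite PS.
have edgeVS (i : 'I_n) : dot (vertex (ordS i)) (P (ordS i)) = 1 by rewrite PE.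
have V_le (i j : 'I_n) : dot (vertex j) (P (ordS i)) <= 1.
  rewrite PE dot_vertex ler_pdivrMr // mul1r.
  exact: (cos_sub_mid_le tP).
have sectorV (X : R * R) : exists j (a b : R),
    [/\ 0 <= a, 0 <= b & X = a *: vertex j + b *: vertex (ordS j)].
  have w0 (i : 'I_n) : 0 < (cos (half_arc t i))^-1 by rewrite invr_gt0.
  have [j [a [b [a0 b0 ->]]]] := sector_steps (steps_mid tP) X w0.
  by exists j, a, b; split => //; rewrite !ltn_ord.
have P1 (i : 'I_n) : dot (P (ordS i)) (P (ordS i)) = 1.
  by rewrite PE dot_circle_ptxx.
have VV (i : 'I_n) : dot (vertex i) (vertex i) = (cos (half_arc t i))^-1 ^+ 2.
  by rewrite dotZl dotZr dot_circle_ptxx mulr1.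
have Vm (i : 'I_n) : dot (vertex i) (vertex i) <= m^-1 ^+ 2.
  by rewrite VV ler_pXn2r ?nnegrE ?invr_ge0 ?(ltW m0) ?(ltW (cos_gt0 i)) // lef_pV2 ?posrE.
have mV : 0 < m^-1 by rewrite invr_gt0.
have V1 : 1 ^+ 2 < dot (vertex i0) (vertex i0).
  by rewrite VV ltr_pXn2r ?nnegrE ?invr_ge0 ?ltW // invf_gt1.
apply/andP; split.
  have := area_gt (fun=> ltr01) edgeV edgeVS V_le sectorV P1 ltr01
    (fun=> lexx _) mV Vm V1.
  by rewrite expr1n mulr1.
have := area_le (fun=> ltr01) edgeV edgeVS V_le sectorV mV Vm.
by rewrite exprVn.
Qed.

(** With [h] the half-arc, [cos h >= cos^2 h = 1 - sin^2 h >= 1 - d^2 / 4 >= 1 - d]. *)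
Lemma mesh_cos_half_arc (d : R) (i : 'I_n) : mesh P < d -> d <= 1 ->
  1 - d <= cos (half_arc t i).
Proof.
move=> Pd d1.
have ed : 2 * sin (half_arc t i) < d.
  rewrite -(edge_length_circuit tP PE); apply: le_lt_trans Pd.
  exact: le_bigmax.
have hb := half_arc_bounds tP (ltn_ord i).
have s0 : 0 <= sin (half_arc t i) by apply: sin_ge0_pi; lra.
have := cos2Dsin2 (half_arc t i); have := cos_gt0 i; have := cos_lt1 i; nra.
Qed.

End CircuitAreas.

(** * Choice of the mesh bound for a given precision *)

Unset Implicit Arguments.

Theorem theorem6 (R : realType) :
  forall eps : R, 0 < eps ->
  exists delta : R, 0 < delta /\
    forall (n : nat) (P : 'I_n -> R * R), is_circuit P ->
      mesh P < delta ->
      (0 < circle_pi - area (inscribed P) < eps) /\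
      (0 < area (circumscribed P) - circle_pi < eps).
Proof.
move=> eps eps0; have pi0 := pi_gt0 R; rewrite circle_piE.
(* As [x <= 1], [pi ((1 + x)^2 - 1) <= 3 pi x <= 3 eps / 4]; the radius [m] below is the inverse of
   [1 + x]. *)
pose x := Num.min 1 (eps / pi / 4).
have epspi : 0 < eps / pi by rewrite divr_gt0.
have x0 : 0 < x by rewrite lt_min ltr01 /= divr_gt0.
have x1 : x <= 1 by rewrite ge_min lexx.
have xe : x <= eps / pi / 4 by rewrite ge_min lexx orbT.
pose m := (1 + x)^-1.
have mx : m * (1 + x) = 1 by rewrite mulVf // gt_eqF //; lra.
have m0 : 0 < m by rewrite invr_gt0; lra.
have m1 : m < 1 by nra.
have upper : pi * m ^- 2 - pi < eps.
  have -> : m ^- 2 = (1 + x) ^+ 2 by rewrite -exprVn invrK.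
  have -> : eps = pi * (eps / pi) by rewrite mulrC divfK // gt_eqF.
  by rewrite -[X in _ - X]mulr1 -mulrBr ltr_pM2l //; nra.
(* Reduces to the circumscribed bound, since [m^2 + m^-2 >= 2] means [1 - m^2 <= m^-2 - 1]. *)
have lower : pi - pi * m ^+ 2 < eps.
  apply: le_lt_trans upper; rewrite -[m ^- 2]exprVn invrK.
  have : 2 <= m ^+ 2 + (1 + x) ^+ 2 by nra.
  nra.
(* For [d = 1 - m] the bound [1 - d <= cos (half_arc t i)] reads [m <= cos (half_arc t i)]. *)
exists (1 - m); split; first by rewrite subr_gt0.
move=> n P [t [tn dt PE]] Pd.
have tP : angular_steps n t by split.
have mc (i : 'I_n) : m <= cos (half_arc t i).
  have d1 : 1 - m <= 1 by rewrite gerBl ltW.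
  by have := mesh_cos_half_arc tP PE i Pd d1; rewrite opprB addrC subrK.
move: (inscribed_area_bounds tP PE m0 mc) (circumscribed_area_bounds tP PE m0 mc).
move: (area (inscribed P)) (area (circumscribed P)) => A B /andP[? ?] /andP[? ?].
by split; apply/andP; split; lra.
Qed.
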